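(* Let $A\in\mathrm{ASM}(n)$ and suppose that $i\in[n-1]$ is a descent of $A$. Suppose that $(i,\ell-1)\in\mathrm{ess}(A)$, and let $j$ be the greatest integer such that $j<\ell$, $(i,j)\in F_i(A)$, and $(i,j-1)\notin F_i(A)$. Define the $n\times n$ matrix $B$ by \[ B_{a,b}=\begin{cases}A_{a,b}, & (a,b)\notin\{(i,j),(i+1,j),(i,\ell),(i+1,\ell)\},\\ A_{a,b}+1, & (a,b)\in\{(i,j),(i+1,\ell)\},\\ A_{a,b}-1, & (a,b)\in\{(i+1,j),(i,\ell)\}.\end{cases} \] Then $B<A$ in strong order (in particular $B\in\mathrm{ASM}(n)$) and $\pi_i(B)=\pi_i(A)$.
   Context: $[n]=\{1,\dots,n\}$. An $n\times n$ alternating sign matrix (ASM) is a matrix $A=(A_{i,j})$ with entries in $\{-1,0,1\}$ such that $\sum_{j=1}^m A_{i,j}\in\{0,1\}$ for all $i,m\in[n]$, $\sum_{i=1}^m A_{i,j}\in\{0,1\}$ for all $j,m\in[n]$, and the sum of all entries is $n$; $\mathrm{ASM}(n)$ is the set of these. The corner sum function of $A$ is $\mathrm{rk}_A(i,j)=\sum_{a\in[i],\,b\in[j]}A_{a,b}$. Strong order on $\mathrm{ASM}(n)$: $A\le B$ iff $\mathrm{rk}_A(i,j)\ge \mathrm{rk}_B(i,j)$ for all $i,j\in[n]$. For $i\in[n-1]$, $\pi_i(A)$ is the minimum, in strong order, of $\{B\in\mathrm{ASM}(n): \mathrm{rk}_B(a,b)=\mathrm{rk}_A(a,b)\text{ for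 all }a,b\in[n]\text{ with }a\ne i\}$ (this minimum is known to exist). $i\in[n-1]$ is a descent of $A$ if $\pi_i(A)<A$. $(i,j)\in[n]\times[n]$ is an inversion of $A$ if $\sum_{k=1}^jA_{i,k}=\sum_{l=1}^iA_{l,j}=0$; $\mathrm{inv}(A)$ is the set of inversions. The essential set is $\mathrm{ess}(A)=\{(i,j)\in\mathrm{inv}(A):(i+1,j)\notin\mathrm{inv}(A),\ (i,j+1)\notin\mathrm{inv}(A)\}$. For $i\in[n-1]$, $F_i(A)=\{(i,j)\in\mathrm{inv}(A):(i+1,j)\notin\mathrm{inv}(A)\}$. *)

(* Defs.v *)
From mathcomp Require Import all_boot all_order all_algebra.
From mathcomp Require Import boolp classical_sets.
From mathcomp Require Import zify.

Set Implicit Arguments.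
Unset Strict Implicit.
Unset Printing Implicit Defensive.

Import Order.TTheory GRing.Theory Num.Theory.

Local Open Scope ring_scope.

(* Row and column numbers are natural numbers counted from 1, so that [entry]
   is the only place where they are matched with the indices of 'M_n, which
   start at 0. Outside [n] x [n] the entry is 0 by convention. *)
Definition entry (n : nat) (A : 'M[int]_n) (i j : nat) : int :=
  match i, j with
  | a.+1, b.+1 =>
      match insub a : option 'I_n, insub b : option 'I_n with
      | Some a', Some b' => A a' b'
      | _, _ => 0
      end
  | _, _ => 0
  end.

Arguments entry : simpl never.

Record is_asm (n : nat) (A : 'M[int]_n) : Prop := IsAsm {
  asm_entry : forall i j, (1 <= i <= n)%N -> (1 <= j <= n)%N ->
    entry A i j \in [:: -1; 0; 1];
  asm_row : forall i m, (1 <= i <= n)%N -> (1 <= m <= n)%N ->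
    \sum_(1 <= j < m.+1) entry A i j \in [:: 0; 1];
  asm_col : forall j m, (1 <= j <= n)%N -> (1 <= m <= n)%N ->
    \sum_(1 <= i < m.+1) entry A i j \in [:: 0; 1];
  asm_total : \sum_(1 <= i < n.+1) \sum_(1 <= j < n.+1) entry A i j = n%:Z
}.

Definition rk (n : nat) (A : 'M[int]_n) (i j : nat) : int :=
  \sum_(1 <= a < i.+1) \sum_(1 <= b < j.+1) entry A a b.

(* The order is reversed with respect to corner sums. *)
Definition strong_le (n : nat) (A B : 'M[int]_n) : Prop :=
  forall i j, (1 <= i <= n)%N -> (1 <= j <= n)%N -> rk B i j <= rk A i j.

Definition strong_lt (n : nat) (A B : 'M[int]_n) : Prop :=
  strong_le A B /\ A <> B.

Definition same_rk_off_row (n : nat) (i : nat) (A : 'M[int]_n) :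
    set 'M[int]_n :=
  [set B | is_asm B /\
    forall a b, (1 <= a <= n)%N -> (1 <= b <= n)%N -> a <> i ->
      rk B a b = rk A a b]%classic.

Definition is_strong_min (n : nat) (S : set 'M[int]_n) (P : 'M[int]_n) : Prop :=
  S P /\ forall Q, S Q -> strong_le P Q.

(* The default value A of [xget] is never used when A is an ASM and
   1 <= i < n: see [pi_op_min] and [is_strong_min_uniq] below. *)
Definition pi_op (n : nat) (i : nat) (A : 'M[int]_n) : 'M[int]_n :=
  xget A [set P | is_strong_min (same_rk_off_row i A) P]%classic.

Definition is_descent (n : nat) (A : 'M[int]_n) (i : nat) : Prop :=
  (1 <= i < n)%N /\ strong_lt (pi_op i A) A.

Definition inv_set (n : nat) (A : 'M[int]_n) : pred (nat * nat) :=
  [pred p : nat * nat |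
    [&& (1 <= p.1 <= n)%N, (1 <= p.2 <= n)%N,
        \sum_(1 <= k < p.2.+1) entry A p.1 k == 0
      & \sum_(1 <= l < p.1.+1) entry A l p.2 == 0]].

Definition ess_set (n : nat) (A : 'M[int]_n) : pred (nat * nat) :=
  [pred p : nat * nat |
    [&& p \in inv_set A, (p.1.+1, p.2) \notin inv_set A
      & (p.1, p.2.+1) \notin inv_set A]].

Definition F_set (n : nat) (i : nat) (A : 'M[int]_n) : pred (nat * nat) :=
  [pred p : nat * nat |
    [&& p.1 == i, p \in inv_set A & (i.+1, p.2) \notin inv_set A]].

(* The indices a b : 'I_n stand for row a.+1 and column b.+1. *)
Definition switch (n : nat) (A : 'M[int]_n) (i j l : nat) : 'M[int]_n :=
  \matrix_(a < n, b < n)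
    if (a.+1, b.+1) \in [:: (i, j); (i.+1, l)] then A a b + 1
    else if (a.+1, b.+1) \in [:: (i.+1, j); (i, l)] then A a b - 1
    else A a b.

Lemma entryE (n : nat) (A : 'M[int]_n) (a b : 'I_n) :
  entry A a.+1 b.+1 = A a b.
Proof. by rewrite /entry !valK. Qed.

Lemma rk0l (n : nat) (A : 'M[int]_n) j : rk A 0 j = 0.
Proof. by rewrite /rk big_nil. Qed.

Lemma rk0r (n : nat) (A : 'M[int]_n) i : rk A i 0 = 0.
Proof. by rewrite /rk big1 // => a _; rewrite big_nil. Qed.

Lemma rk_recl (n : nat) (A : 'M[int]_n) i j :
  rk A i.+1 j = rk A i j + \sum_(1 <= b < j.+1) entry A i.+1 b.
Proof. by rewrite /rk big_nat_recr. Qed.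

Lemma rk_recr (n : nat) (A : 'M[int]_n) i j :
  rk A i j.+1 = rk A i j + \sum_(1 <= a < i.+1) entry A a j.+1.
Proof.
by rewrite /rk -big_split /=; apply: eq_bigr => a _; rewrite big_nat_recr.
Qed.

Lemma rk_entry (n : nat) (A : 'M[int]_n) i j :
  entry A i.+1 j.+1 = rk A i.+1 j.+1 - rk A i j.+1 - (rk A i.+1 j - rk A i j).
Proof.
rewrite !rk_recl big_nat_recr //= [rk A i j.+1 + _ - _]addrC addKr.
by rewrite [rk A i j + _ - _]addrC addKr addrAC subrr add0r.
Qed.

Lemma rk_inj (n : nat) (A B : 'M[int]_n) :
  (forall i j, (1 <= i <= n)%N -> (1 <= j <= n)%N -> rk A i j = rk B i j) ->
  A = B.
Proof.
move=> rkAB; have rkE i j : (i <= n)%N -> (j <= n)%N -> rk A i j = rk B i j.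
  case: i => [|i] lei; first by rewrite !rk0l.
  case: j => [|j] lej; first by rewrite !rk0r.
  exact: rkAB.
apply/matrixP=> a b; rewrite -!entryE !rk_entry.
have := ltn_ord a; have := ltn_ord b => ltb lta.
by rewrite !rkE ?(ltnW lta) ?(ltnW ltb).
Qed.

Lemma strong_le_anti (n : nat) (A B : 'M[int]_n) :
  strong_le A B -> strong_le B A -> A = B.
Proof.
move=> AB BA; apply: rk_inj => i j i_n j_n.
by apply/eqP; rewrite eq_le AB ?BA.
Qed.

Lemma is_strong_min_uniq (n : nat) (S : set 'M[int]_n) (P Q : 'M[int]_n) :
  is_strong_min S P -> is_strong_min S Q -> P = Q.
Proof.
by move=> [SP minP] [SQ minQ]; apply: strong_le_anti; [apply: minP|apply: minQ].
Qed.

Lemma is_asm_rkP (n : nat) (A : 'M[int]_n) :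
  is_asm A <->
  [/\ forall i j, (i < n)%N -> (j <= n)%N ->
        rk A i j <= rk A i.+1 j <= rk A i j + 1,
      forall i j, (i <= n)%N -> (j < n)%N ->
        rk A i j <= rk A i j.+1 <= rk A i j + 1
    & rk A n n = n%:Z].
Proof.
split=> [[_ row col tot]|[row col tot]].
  split=> // [i [|j]|[|i] j] lti ltj; rewrite ?rk0l ?rk0r //.
    by have := row i.+1 j.+1 lti ltj; rewrite rk_recl !inE; lia.
  by have := col j.+1 i.+1 ltj lti; rewrite rk_recr !inE; lia.
split=> // [[//|i] [//|j] lti ltj|[//|i] m lti ltm|[//|j] m ltj ltm].
- have := row i j.+1 lti ltj; have := row i j lti (ltnW ltj).
  by rewrite rk_entry !inE; lia.
- have lem : (m <= n)%N by case/andP: ltm.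
  by have := row i m lti lem; rewrite rk_recl !inE; lia.
- have lem : (m <= n)%N by case/andP: ltm.
  by have := col m j lem ltj; rewrite rk_recr !inE; lia.
Qed.

Lemma rk_of_fun (n : nat) (R : nat -> nat -> int) :
  (forall j, R 0 j = 0) -> (forall i, R i 0 = 0) ->
  exists P : 'M[int]_n,
    forall i j, (i <= n)%N -> (j <= n)%N -> rk P i j = R i j.
Proof.
move=> R0l R0r.
exists (\matrix_(a < n, b < n)
  (R a.+1 b.+1 - R a b.+1 - (R a.+1 b - R a b))).
set P := \matrix_(_, _) _.
have PE i j : (i < n)%N -> (j < n)%N ->
    entry P i.+1 j.+1 = R i.+1 j.+1 - R i j.+1 - (R i.+1 j - R i j).
  by move=> lti ltj; rewrite (entryE P (Ordinal lti) (Ordinal ltj)) mxE.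
elim=> [|i IHi]; first by move=> j _ _; rewrite rk0l R0l.
elim=> [|j IHj] lti ltj; first by rewrite rk0r R0r.
have := rk_entry P i j; rewrite PE // (IHi j.+1) ?(IHi j) ?IHj //; lia.
Qed.

Lemma ex_strong_min (n : nat) (A : 'M[int]_n) (i : nat) :
  is_asm A -> (1 <= i < n)%N ->
  exists P, is_strong_min (same_rk_off_row i A) P.
Proof.
move=> /is_asm_rkP[row col tot]; case: i => [//|i] /= lti.
pose R a b := if a == i.+1 then Num.min (rk A i b + 1) (rk A i.+2 b)
              else rk A a b.
have [||P PE] := @rk_of_fun n R.
- by move=> b; rewrite /R rk0l.
- by move=> a; rewrite /R !rk0r; case: ifP.
exists P; split; first split.
- apply/is_asm_rkP; split.
  + move=> a b lta leb; rewrite !PE ?(ltnW lta) // /R eqSS.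
    have h1 := row i b (ltnW lti) leb; have h2 := row i.+1 b lti leb.
    case: (eqVneq a i.+1) => [->|_].
      by rewrite -[i.+1 == i]/(i.+1 == i)%N gtn_eqF //; lia.
    by case: (eqVneq a i) => [->|_]; [lia|apply: row].
  + move=> a b lea ltb; rewrite !PE ?(ltnW ltb) // /R.
    case: eqP => [_|_]; last exact: col.
    have h1 := col i b (ltnW (ltnW lti)) ltb.
    have h2 := col i.+2 b lti ltb.
    by lia.
  + by rewrite PE // /R gtn_eqF.
- move=> a b /andP[_ lea] /andP[_ leb] /eqP nai.
  by rewrite PE // /R (negPf nai).
move=> Q [/is_asm_rkP[rowQ colQ _] QE] a b a_n b_n.
have [/andP[_ lea] /andP[_ leb]] := (a_n, b_n).
rewrite PE // /R; case: (eqVneq a i.+1) => [->|/eqP nai]; last first.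
  by rewrite QE.
have h1 := rowQ i b (ltnW lti) leb; have h2 := rowQ i.+1 b lti leb.
have e2 : rk Q i.+2 b = rk A i.+2 b by apply: QE => //; lia.
have e1 : rk Q i b = rk A i b.
  by case: (posnP i) => [->|i_gt0]; [rewrite !rk0l|apply: QE => //; lia].
by lia.
Qed.

Lemma pi_op_min (n : nat) (A : 'M[int]_n) (i : nat) :
  is_asm A -> (1 <= i < n)%N ->
  is_strong_min (same_rk_off_row i A) (pi_op i A).
Proof.
move=> asmA i_n; have [P minP] := ex_strong_min asmA i_n.
by apply: (xgetPex A); exists P.
Qed.

(* Main.v *)
Require Import Defs.
From mathcomp Require Import all_boot all_order all_algebra.
From mathcomp Require Import boolp zify.

Set Implicit Arguments.
Unset Strict Implicit.
Unset Printing Implicit Defensive.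

Import Order.TTheory GRing.Theory Num.Theory.

Local Open Scope ring_scope.

(** Everything is read off the corner sums. The switch raises [rk A i b] by one
    for j <= b < l and changes no other corner sum ([rk_switch]). As
    larger corner sums mean a smaller matrix, the result lies below A, strictly
    because j < l. As only row i of the corner sums moves, the switch also
    leaves the set whose minimum defines [pi_op i] unchanged
    ([pi_op_eq_off_row]).

    What remains is that the raised corner sums still come from an ASM, that
    is, that neighbouring ones still differ by 0 or 1 ([is_asm_switch]).
    Vertically, this asks that for j <= b < l the corner sum at (i, b) equals
    the one above it and is one less than the one below it; this holds at every
    element of F_i(A) ([F_set_rk]), and by the maximality of j the whole
    interval [j, l - 1] lies in F_i(A) ([run_mem]). Horizontally, only the two
    ends of the interval matter: there is no step of [rk A i] into column j
    because (i, j) is an inversion, and there is a step into column l because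
    (i, l - 1) is an inversion and (i, l) is not ([rk_step_after_inv]). *)

(** The four changed entries are the mixed differences of the indicator
    function of the cells (i, b) with j <= b < l. *)
Lemma rk_switch (n : nat) (A : 'M[int]_n) (i j l : nat) :
  (0 < i)%N -> (0 < j)%N -> (j < l)%N ->
  forall a b, (a <= n)%N -> (b <= n)%N ->
  rk (switch A i j l) a b = rk A a b + ((a == i) && (j <= b < l)%N)%:Z.
Proof.
move=> i_gt0 j_gt0 ltjl.
pose R a b : int := rk A a b + ((a == i) && (j <= b < l)%N)%:Z.
have [||P PE] := @rk_of_fun n R.
- by move=> b; rewrite /R rk0l; lia.
- by move=> a; rewrite /R rk0r; lia.
suff -> : switch A i j l = P by [].
apply/matrixP=> a b; rewrite mxE -!entryE !rk_entry.
have lta := ltn_ord a; have ltb := ltn_ord b.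
rewrite !PE ?(ltnW lta) ?(ltnW ltb) // /R !inE !xpair_eqE.
by case: ifP => ?; [|case: ifP => ?]; lia.
Qed.

Lemma is_asm_switch (n : nat) (A : 'M[int]_n) (i j l : nat) :
  is_asm A -> (0 < i < n)%N -> (0 < j < l)%N -> (l <= n)%N ->
  (forall b, (j <= b < l)%N ->
     rk A i b = rk A i.-1 b /\ rk A i.+1 b = rk A i b + 1) ->
  rk A i j = rk A i j.-1 -> rk A i l = rk A i l.-1 + 1 ->
  is_asm (switch A i j l).
Proof.
move=> /is_asm_rkP[row col tot] /andP[i_gt0 ltin] /andP[j_gt0 ltjl] leln.
move=> vert left right; have rkE := rk_switch A i_gt0 j_gt0 ltjl.
apply/is_asm_rkP; split.
- move=> a b lta leb; rewrite !rkE ?(ltnW lta) //.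
  have rowab := row a b lta leb.
  case: (boolP (j <= b < l)%N) => [jbl|_]; last by rewrite !andbF; lia.
  have [eq_up eq_down] := vert b jbl; rewrite !andbT.
  case: (eqVneq a i) => [eai|_]; first by subst a; lia.
  case: (eqVneq a.+1 i) => [eai|_]; last by lia.
  by move: eq_up; rewrite -eai /=; lia.
- move=> a b lea ltb; rewrite !rkE ?(ltnW ltb) //.
  have colab := col a b lea ltb.
  case: (eqVneq a i) => [eai|_]; last by rewrite /=; lia.
  subst a => /=.
  case: (eqVneq b.+1 j) => [ebj|nbj].
    by move: left; rewrite -ebj /=; lia.
  case: (eqVneq b.+1 l) => [ebl|nbl]; last by lia.
  by move: right; rewrite -ebl /=; lia.
- by rewrite rkE // (gtn_eqF ltin); lia.
Qed.

(** The two partial sums in the definition of an inversion are the vertical and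
    horizontal differences of the corner sum function. *)
Lemma inv_setE (n : nat) (A : 'M[int]_n) (i j : nat) :
  ((i, j) \in inv_set A) =
  [&& (1 <= i <= n)%N, (1 <= j <= n)%N,
      rk A i j == rk A i.-1 j & rk A i j == rk A i j.-1].
Proof.
rewrite inE /=; case: i => [//|i]; case: j => [|j]; first by rewrite !andbF.
rewrite /=; congr [&& _, _, _ & _].
  by rewrite -[RHS]subr_eq0 rk_recl addrAC subrr add0r.
by rewrite -[RHS]subr_eq0 rk_recr addrAC subrr add0r.
Qed.

Lemma F_setE (n : nat) (A : 'M[int]_n) (i b : nat) :
  ((i, b) \in F_set i A) =
  ((i, b) \in inv_set A) && ((i.+1, b) \notin inv_set A).
Proof. by rewrite [LHS]inE /= eqxx. Qed.

(** If the corner sums at (i, b) and (i + 1, b) agreed, then, (i, b) being an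
    inversion while (i + 1, b) is not, the one at (i + 1, b - 1) would be
    smaller than the one above it. *)
Lemma F_set_rk (n : nat) (A : 'M[int]_n) (i b : nat) :
  is_asm A -> (i < n)%N -> (i, b) \in F_set i A ->
  rk A i b = rk A i.-1 b /\ rk A i.+1 b = rk A i b + 1.
Proof.
move=> /is_asm_rkP[row col _] ltin; rewrite F_setE !inv_setE /=.
case: b => [|b]; first by lia.
case/andP=> /and4P[i_n /= ltb /eqP eq_up /eqP eq_left] notinv.
have row0 := row i b ltin (ltnW ltb); have row1 := row i b.+1 ltin ltb.
have col1 := col i.+1 b ltin ltb.
split=> //; move: notinv; rewrite ltin ltb /= => notinv.
have [eqd|ned] := eqVneq (rk A i.+1 b.+1) (rk A i b.+1); last by lia.
by move: notinv; rewrite eqd eqxx /=; lia.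
Qed.

(** If the step into column j + 1 is not made by [rk A i] itself, then (i, j + 1)
    fails to be an inversion because [rk A i] exceeds [rk A i.-1] there; as the
    two agree at column j and [rk A i.-1] does not decrease, [rk A i] has to
    step after all. The bound [j < n] comes for free: the entries of a row of an
    ASM sum to 1, so the last column has no inversion. *)
Lemma rk_step_after_inv (n : nat) (A : 'M[int]_n) (i j : nat) :
  is_asm A -> (i, j) \in inv_set A -> (i, j.+1) \notin inv_set A ->
  (j < n)%N /\ rk A i j.+1 = rk A i j + 1.
Proof.
move=> /is_asm_rkP[row col tot]; rewrite !inv_setE /=.
case: i => [//|i] /and4P[/= ltin /andP[j_gt0 lejn] /eqP eq_up /eqP eq_left].
(* The corner sums of the last column climb from 0 to n in n steps of at most
   one, so every step is one. *)
have rkn k : (k <= n)%N -> rk A k n = k%:Z.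
  move=> lekn.
  have ub m : (m <= n)%N -> rk A m n <= m%:Z.
    elim: m => [|m IHm] lem; first by rewrite rk0l.
    by have := row m n lem (leqnn n); have := IHm (ltnW lem); lia.
  have lb m : (m <= n)%N -> n%:Z - m%:Z <= rk A (n - m) n.
    elim: m => [|m IHm] lem; first by rewrite subn0 tot; lia.
    have := row (n - m.+1)%N n; rewrite subnSK // => /(_ (leq_subr _ _)).
    by have := IHm (ltnW lem); lia.
  by have := ub k lekn; have := lb _ (leq_subr k n); rewrite subKn //; lia.
have ltjn : (j < n)%N.
  rewrite ltn_neqAle lejn andbT; apply/eqP => ejn; move: eq_up.
  by rewrite ejn !rkn ?(ltnW ltin) //; lia.
move=> notinv; split=> //.
have row0 := row i j.+1 ltin ltjn.
have coli := col i j (ltnW ltin) ltjn; have coli1 := col i.+1 j ltin ltjn.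
move: notinv; rewrite ltin ltjn /=; lia.
Qed.

(** Going down from [m], membership can only be lost just below a left end of a
    run, and [j] is the last left end. *)
Lemma run_mem (P : pred nat) (j m : nat) :
  P m ->
  (forall k, (k <= m)%N -> P k -> ~~ P (k - 1)%N -> (k <= j)%N) ->
  forall b, (j <= b <= m)%N -> P b.
Proof.
move=> Pm maxj b /andP[lejb lebm]; rewrite -(subKn lebm).
have : (m - b <= m - j)%N by lia.
elim: (m - b)%N => [|d IHd] led; first by rewrite subn0.
apply/contraT => nP.
have := maxj (m - d)%N (leq_subr _ _) (IHd (ltnW led)).
by rewrite -subnDA addn1 => /(_ nP); lia.
Qed.

Lemma pi_op_eq_off_row (n : nat) (A B : 'M[int]_n) (i : nat) :
  is_asm A -> is_asm B -> (1 <= i < n)%N ->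
  (forall a b, (1 <= a <= n)%N -> (1 <= b <= n)%N -> a <> i ->
     rk B a b = rk A a b) ->
  pi_op i B = pi_op i A.
Proof.
move=> asmA asmB i_n eqAB; apply: (is_strong_min_uniq (pi_op_min asmB i_n)).
suff -> : same_rk_off_row i B = same_rk_off_row i A by apply: pi_op_min.
apply/funext => C; apply/propext; split=> -[asmC eqC]; split=> // a b ha hb nai.
  by rewrite eqC ?eqAB.
by rewrite eqC ?eqAB.
Qed.

Theorem proposition4p4 (n : nat) (A : 'M[int]_n) (i j l : nat)
  (asmA : is_asm A)
  (i_range : (1 <= i <= n.-1)%N)
  (descA : is_descent A i)
  (ess_l : (i, l - 1)%N \in ess_set A)
  (j_lt : (j < l)%N)
  (j_in : (i, j) \in F_set i A)
  (j_start : (i, j - 1)%N \notin F_set i A)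
  (j_max : forall k : nat, (k < l)%N -> (i, k) \in F_set i A ->
     (i, k - 1)%N \notin F_set i A -> (k <= j)%N) :
  let B := switch A i j l in
  is_asm B /\ strong_lt B A /\ pi_op i B = pi_op i A.
Proof.
move=> B.
have i_n : (1 <= i < n)%N by lia.
have [i_gt0 ltin] := andP i_n.
case: l ess_l j_lt j_max @B => [|l] // ess_l lejl j_max B.
rewrite subn1 in ess_l.
have /and3P[/= l_inv l_down l_right] : [&& (i, l) \in inv_set A,
  (i.+1, l) \notin inv_set A & (i, l.+1) \notin inv_set A] by [].
have l_in : (i, l) \in F_set i A by rewrite F_setE l_inv.
have [ltln stepl] := rk_step_after_inv asmA l_inv l_right.
have run b : (j <= b <= l)%N -> (i, b) \in F_set i A.
  by apply: (run_mem (P := fun b => (i, b) \in F_set i A)).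
have [j_n stepj] : (1 <= j <= n)%N /\ rk A i j = rk A i j.-1.
  by move: j_in; rewrite F_setE inv_setE => /andP[/and4P[_ ? _ /eqP]].
have [j_gt0 lejn] := andP j_n.
have rkB := rk_switch A i_gt0 j_gt0 lejl.
have asmB : is_asm B.
  apply: is_asm_switch => //; first by rewrite j_gt0.
  by move=> b jbl; apply: F_set_rk => //; apply: run.
split=> //; split.
  split=> [a b /andP[_ lea] /andP[_ leb]|eqBA]; first by rewrite rkB //; lia.
  have := rkB i j (ltnW ltin) lejn.
  by rewrite -/B eqBA eqxx leqnn lejl /=; lia.
apply: pi_op_eq_off_row => // a b /andP[_ lea] /andP[_ leb] /eqP nai.
by rewrite rkB // (negPf nai) addr0.
Qed.
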